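(* Let $S$ be a complete semiring, $(\mathbf{C},\otimes,I)$ a small strict monoidal category, and $\mathcal{F}$ a system of fields. If $M$ and $N$ are closed $n$-manifolds and $M\sqcup N$ is their ordered disjoint union, then the restrictions to $M$ and $N$ (that is, the map $\overline{\mathcal{F}}(M\sqcup N)\to\overline{\mathcal{F}}(M)\times\overline{\mathcal{F}}(N)$, $[f]\mapsto([f|_M],[f|_N])$) induce an isomorphism $$Z(M\sqcup N)\cong Z(M)\,\widehat{\otimes}\,Z(N)$$ of two-sided $Q^c$-semialgebras and of two-sided $Q^m$-semialgebras.
   Context: A semiring $(S,+,\cdot,0,1)$ consists of a commutative monoid $(S,+,0)$ and a (not necessarily commutative) monoid $(S,\cdot,1)$ such that $\cdot$ distributes over $+$ from both sides and $0$ is absorbing. A complete monoid is a commutative monoid $(M,+,0)$ with a summation law assigning to every family $(m_i)_{i\in I}$, $I$ an arbitrary set, an element $\sum_{i\in I}m_i$ such that $\sum_{i\in\varnothing}m_i=0$, $\sum_{i\in\{1\}}m_i=m_1$, $\sum_{i\in\{1,2\}}m_i=m_1+m_2$, and $\sum_{j\in J}\big(\sum_{i\in I_j}m_i\big)=\sum_{i\in I}m_i$ for every partition $I=\bigcup_{j\in J}I_j$. A semiring is complete if $(S,+,0,\sum)$ is a complete monoid and $\sum_i ss_i=s\sum_i s_i$, $\sum_i s_is=(\sum_i s_i)s$. $Q=Q_S(\mathbf{C})$ is the complete monoid of functions $\operatorname{Mor}(\mathbf{C})\to S$ with pointwise addition and summation. It carries two complete semiring structures: $Q^c=(Q,+,\cdot,0,1)$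 with $(a\cdot b)(\gamma)=\sum_{\beta\circ\alpha=\gamma}b(\beta)a(\alpha)$ and $1$ the characteristic function of the set of identity morphisms; $Q^m=(Q,+,\times,0,1^\times)$ with $(a\times b)(\gamma)=\sum_{\alpha\otimes\beta=\gamma}b(\beta)a(\alpha)$ and $1^\times$ the characteristic function of $\operatorname{id}_I$. A two-sided $R$-semialgebra ($R$ a semiring) is a semiring $A$ which is also an $R$-$R$-bisemimodule with $r(ab)=(ra)b$ and $(ab)r=a(br)$; morphisms are semiring morphisms that are also bisemimodule homomorphisms. For a set $A$, $\operatorname{Fun}_Q(A)$ is the set of functions $A\to Q$; with pointwise operations and scalar multiplications it is a two-sided $Q^c$-semialgebra (using $\cdot$) and a two-sided $Q^m$-semialgebra (using $\times$). A map $\phi:A\to B$ induces $\operatorname{Fun}_Q(B)\to\operatorname{Fun}_Q(A)$, $z\mapsto z\circ\phi$. The functional tensor product is $\operatorname{Fun}_Q(A)\,\widehat{\otimes}\,\operatorname{Fun}_Q(B):=\operatorname{Fun}_Q(A\times B)$. Fix an integer $n\ge 0$. Manifolds are topological and need not be orientable; $\varnothing$ is a manifold of every dimension; $\sqcup$ is the ordered disjoint union. A bordism from $M$ to $N$ is a triple $(W,M,N)$ (often abbreviated $W$) with $W$ a compact $(n+1)$-dimensional topological manifold, $\partial W=M\sqcup N$, where the closed $n$-manifolds $M,N$ are the incoming and outgoing boundary. $(W,M,N)\sqcup(W',M',N')=(W\sqcup W',M\sqcup M',N\sqcup N')$. If $W'$ is a bordism from $M$ to $N$ and $W''$ a bordism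 from $N$ to $P$, gluing along $N$ yields the bordism $W'\cup_N W''$ from $M$ to $P$. A homeomorphism of bordisms is a homeomorphism preserving incoming and outgoing boundaries. $(W_0,M_0,N_0)$ is a subbordism of $(W,M,N)$ if $W_0\subset W$ is a codimension $0$ submanifold, every connected component $C$ of $M_0$ satisfies $C\cap\partial W=\varnothing$ or $C\subset M$, and every connected component $C$ of $N_0$ satisfies $C\cap\partial W=\varnothing$ or $C\subset N$. A system $\mathcal{F}$ of fields assigns to each bordism $W$ a set $\mathcal{F}(W)$ and to each closed $n$-manifold $M$ a set $\mathcal{F}(M)$, with $\mathcal{F}(\varnothing)$ a one-element set, such that: (FRES) There are restriction maps $\mathcal{F}(W)\to\mathcal{F}(W_0)$ for subbordisms $W_0\subset W$, $\mathcal{F}(M)\to\mathcal{F}(M_0)$ for codimension $0$ submanifolds $M_0\subset M$, and $\mathcal{F}(W)\to\mathcal{F}(M)$ for closed codimension $1$ submanifolds $M\subset W$; they are written $f\mapsto f|_{(-)}$ and commute with each other in the obvious way (restricting in stages equals restricting directly). (FHOMEO) A homeomorphism of bordisms $\phi:W\to W'$ induces a bijection $\phi^*:\mathcal{F}(W')\to\mathcal{F}(W)$ with $(\operatorname{id}_W)^*=\operatorname{id}$, $(\psi\circ\phi)^*=\phi^*\circ\psi^*$; similarly for homeomorphisms of closed $n$-manifolds; these maps commute with the restriction maps. (FDISJ) The products of restrictions $\mathcal{F}(W\sqcup W')\to\mathcal{F}(W)\times\mathcal{F}(W')$ and $\mathcal{F}(M\sqcup N)\to\mathcal{F}(M)\times\mathcal{F}(N)$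 are bijections. (FGLUE) For $W=W'\cup_N W''$, the map $\mathcal{F}(W)\to\mathcal{F}(W')\times_{\mathcal{F}(N)}\mathcal{F}(W'')$ given by the restrictions to $W'$ and $W''$ is a bijection onto the pullback. For a closed $n$-manifold $M$, $\overline{\mathcal{F}}(M)$ is the set of equivalence classes of $\mathcal{F}(M)$ under: $f\sim g$ if $g=\phi^*f$ for some homeomorphism $\phi:M\to M$ isotopic to the identity (an isotopy being a homotopy through homeomorphisms). The state module is $Z(M)=\operatorname{Fun}_Q(\overline{\mathcal{F}}(M))$, and $Z(M)\,\widehat{\otimes}\,Z(N)=\operatorname{Fun}_Q(\overline{\mathcal{F}}(M)\times\overline{\mathcal{F}}(N))$. *)

(* Defs.v *)
From HB Require Import structures.
From mathcomp Require Import all_boot all_order all_algebra.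
From mathcomp Require Import all_classical all_reals all_analysis.

Set Implicit Arguments.
Unset Strict Implicit.
Unset Printing Implicit Defensive.

Import Order.TTheory GRing.Theory Num.Theory.
Import numFieldNormedType.Exports.

Local Open Scope classical_set_scope.
Local Open Scope ring_scope.

(* A partition of I into disjoint (possibly empty) blocks I_j, j : J, is given
   by the function p : I -> J sending i to the index of its block.  In
   [csum_single] the index set is an arbitrary one-element type, since in type
   theory the blocks of a partition are not literally the set {1}. *)
HB.mixin Record Nmodule_isCompleteMonoid M of GRing.Nmodule M := {
  csum : forall I : Type, (I -> M) -> M;
  csum_empty : forall (I : Type) (m : I -> M), (I -> False) -> csum I m = 0;
  csum_single : forall (I : Type) (m : I -> M) (i0 : I),
    (forall i, i = i0) -> csum I m = m i0;
  csum_pair : forall m : bool -> M, csum bool m = m true + m false;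
  csum_partition : forall (I J : Type) (p : I -> J) (m : I -> M),
    csum J (fun j => csum {i : I | p i = j} (fun i => m (sval i))) = csum I m
}.

#[short(type="completeMonoidType")]
HB.structure Definition CompleteMonoid :=
  {M of GRing.Nmodule M & Nmodule_isCompleteMonoid M}.

Arguments csum {s} [I] m.
Arguments csum_empty {s} [I] m.
Arguments csum_single {s} [I] m i0.
Arguments csum_pair {s} m.
Arguments csum_partition {s} [I J] p m.

HB.mixin Record PzSemiRing_isComplete S
    of GRing.PzSemiRing S & CompleteMonoid S := {
  csum_mulr : forall (I : Type) (s : S) (m : I -> S),
    csum (fun i => s * m i) = s * csum m;
  csum_mull : forall (I : Type) (s : S) (m : I -> S),
    csum (fun i => m i * s) = csum m * s
}.

#[short(type="completeSemiRingType")]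
HB.structure Definition CompleteSemiRing :=
  {S of GRing.PzSemiRing S & CompleteMonoid S & PzSemiRing_isComplete S}.

Section CompleteMonoidTheory.
Variable M : completeMonoidType.

Lemma eq_csum (I : Type) (m m' : I -> M) : m =1 m' -> csum m = csum m'.
Proof. by move=> /funext ->. Qed.

Lemma csum0 (I : Type) : csum (fun _ : I => 0 : M) = 0.
Proof.
pose p : False -> I := fun x => match x with end.
pose z : False -> M := fun x => match x with end.
rewrite -[RHS](csum_empty z id) -(csum_partition p z).
by apply: eq_csum => j; rewrite csum_empty // => -[].
Qed.

Lemma csum_reindex (I J : Type) (h : I -> J) (k : J -> I) (m : J -> M) :
  cancel h k -> cancel k h -> csum (fun i => m (h i)) = csum m.
Proof.
move=> hk kh; rewrite -(csum_partition h); apply: eq_csum => j.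
rewrite (csum_single _ (exist _ (k j) (kh j))) /= ?kh // => -[i hi].
by apply: eq_exist; rewrite -hi hk.
Qed.

Lemma csum_sig (I : Type) (B : I -> Type) (m : forall i, B i -> M) :
  csum (fun i => csum (m i)) = csum (fun x : {i : I & B i} => m _ (projT2 x)).
Proof.
rewrite -(csum_partition (@projT1 I B)); apply: eq_csum => i.
pose h j (b : B j) : {x : {i : I & B i} | projT1 x = j} :=
  exist _ (existT B j b) erefl.
pose k j (x : {x : {i : I & B i} | projT1 x = j}) : B j :=
  let: exist x e := x in eq_rect _ B (projT2 x) _ e.
rewrite -(@csum_reindex _ _ (h i) (k i)) // => -[[i' b] /= e].
by subst i.
Qed.

Lemma csumD (I : Type) (m m' : I -> M) :
  csum (fun i => m i + m' i) = csum m + csum m'.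
Proof.
pose n (b : bool) i := if b then m i else m' i.
transitivity (csum (fun i => csum (fun b => n b i))).
  by apply: eq_csum => i; rewrite csum_pair.
rewrite -[RHS](csum_pair (fun b => csum (n b))) !csum_sig.
pose swap (A B : Type) (x : {_ : A & B}) : {_ : B & A} :=
  existT _ (projT2 x) (projT1 x).
by rewrite -(@csum_reindex _ _ (swap I bool) (swap bool I)) // => -[].
Qed.

Lemma csum_support1 (I : Type) (m : I -> M) (i0 : I) :
  (forall i, i <> i0 -> m i = 0) -> csum m = m i0.
Proof.
move=> m0; rewrite -(csum_partition (fun i => `[< i = i0 >])) csum_pair.
have e0 : `[< i0 = i0 >] = true by apply/asboolP.
rewrite (csum_single _ (exist _ i0 e0)) /=; last first.
  by move=> [i hi]; apply: eq_exist; apply/asboolP.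
rewrite (_ : csum _ = 0) ?addr0 // -[RHS](csum0 {i | `[< i = i0 >] = false}).
by apply: eq_csum => -[i /= hi]; apply: m0 => /asboolP; rewrite hi.
Qed.

End CompleteMonoidTheory.

Record category := Category {
  ob : Type;
  hom : ob -> ob -> Type;
  idm : forall X, hom X X;
  comp : forall X Y Z, hom Y Z -> hom X Y -> hom X Z;
  comp1m : forall X Y (f : hom X Y), comp (idm Y) f = f;
  compm1 : forall X Y (f : hom X Y), comp f (idm X) = f;
  compA : forall X Y Z T (h : hom Z T) (g : hom Y Z) (f : hom X Y),
    comp h (comp g f) = comp (comp h g) f
}.

Arguments idm {c} X.
Arguments comp {c} [X Y Z] g f.

Record mor (C : category) := Mor { src : ob C; tgt : ob C; arr : hom src tgt }.

Arguments Mor {C} [src tgt] arr.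

(* Strictness equates morphisms whose (co)domains are equal but not convertible,
   so the unit and associativity laws are stated in Mor(C). *)
Record strictMonoidalCategory := StrictMonoidalCategory {
  underlying_cat :> category;
  tensor_ob : ob underlying_cat -> ob underlying_cat -> ob underlying_cat;
  unit_ob : ob underlying_cat;
  tensor_hom : forall X Y X' Y' : ob underlying_cat,
    hom X Y -> hom X' Y' -> hom (tensor_ob X X') (tensor_ob Y Y');
  tensor_hom1 : forall X X' : ob underlying_cat,
    tensor_hom (idm X) (idm X') = idm (tensor_ob X X');
  tensor_hom_comp : forall (X Y Z X' Y' Z' : ob underlying_cat)
      (g : hom Y Z) (f : hom X Y) (g' : hom Y' Z') (f' : hom X' Y'),
    tensor_hom (comp g f) (comp g' f') =
    comp (tensor_hom g g') (tensor_hom f f');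
  tensor_obA : forall X Y Z : ob underlying_cat,
    tensor_ob X (tensor_ob Y Z) = tensor_ob (tensor_ob X Y) Z;
  tensor_ob1m : forall X : ob underlying_cat, tensor_ob unit_ob X = X;
  tensor_obm1 : forall X : ob underlying_cat, tensor_ob X unit_ob = X;
  tensor_homA : forall (X Y X' Y' X'' Y'' : ob underlying_cat)
      (f : hom X Y) (g : hom X' Y') (h : hom X'' Y''),
    Mor (tensor_hom f (tensor_hom g h)) = Mor (tensor_hom (tensor_hom f g) h);
  tensor_hom1m : forall (X Y : ob underlying_cat) (f : hom X Y),
    Mor (tensor_hom (idm unit_ob) f) = Mor f;
  tensor_homm1 : forall (X Y : ob underlying_cat) (f : hom X Y),
    Mor (tensor_hom f (idm unit_ob)) = Mor f
}.

Definition tensor_mor (C : strictMonoidalCategory) (f g : mor C) : mor C :=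
  Mor (tensor_hom (arr f) (arr g)).

(* The pairs (alpha, beta) of morphisms with beta o alpha = gamma: any such
   pair has src alpha = src gamma and tgt beta = tgt gamma. *)
Record comp_factor (C : category) (gamma : mor C) := CompFactor {
  cf_mid : ob C;
  cf_beta : hom cf_mid (tgt gamma);
  cf_alpha : hom (src gamma) cf_mid;
  cf_eq : comp cf_beta cf_alpha = arr gamma
}.

Arguments CompFactor {C gamma} [cf_mid] cf_beta cf_alpha cf_eq.

Record tensor_factor (C : strictMonoidalCategory) (gamma : mor C) :=
  TensorFactor {
  tf_alpha : mor C;
  tf_beta : mor C;
  tf_eq : tensor_mor tf_alpha tf_beta = gamma
}.

Arguments TensorFactor {C gamma} tf_alpha tf_beta tf_eq.

(* Two names for the functions Mor(C) -> S, one for each semiring structure. *)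
Definition Qc (S : completeSemiRingType) (C : category) : Type := mor C -> S.

Definition Qm (S : completeSemiRingType) (C : strictMonoidalCategory) : Type :=
  mor C -> S.

Section CompositionSemiring.
Variables (S : completeSemiRingType) (C : category).

HB.instance Definition _ := GRing.Nmodule.copy (Qc S C) (mor C -> S).

Definition qc_one : Qc S C :=
  fun gamma => if `[< exists X, gamma = Mor (idm X) >] then 1 else 0.

Definition qc_mul (a b : Qc S C) : Qc S C := fun gamma =>
  csum (fun p : comp_factor gamma => b (Mor (cf_beta p)) * a (Mor (cf_alpha p))).

Let qc_mulA : associative qc_mul.
Proof.
move=> a b c; apply/funext => gamma; rewrite /qc_mul.
under eq_csum do rewrite -csum_mull.
under [RHS]eq_csum do rewrite -csum_mulr.
rewrite !csum_sig.
case: gamma => X Y g.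
pose A := {p : comp_factor (Mor g) & comp_factor (Mor (cf_beta p))}.
pose B := {p : comp_factor (Mor g) & comp_factor (Mor (cf_alpha p))}.
have hP (p : comp_factor (Mor g)) (q : comp_factor (Mor (cf_beta p))) :
    comp (cf_beta q) (comp (cf_alpha q) (cf_alpha p)) = g.
  by rewrite compA (cf_eq q) (cf_eq p).
have kP (p : comp_factor (Mor g)) (q : comp_factor (Mor (cf_alpha p))) :
    comp (comp (cf_beta p) (cf_beta q)) (cf_alpha q) = g.
  by rewrite -compA (cf_eq q) (cf_eq p).
pose h (x : A) : B := existT (fun p => comp_factor (Mor (cf_alpha p)))
  (@CompFactor C (Mor g) _ (cf_beta (projT2 x))
     (comp (cf_alpha (projT2 x)) (cf_alpha (projT1 x))) (hP _ (projT2 x)))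
  (@CompFactor C (Mor (comp (cf_alpha (projT2 x)) (cf_alpha (projT1 x)))) _
     (cf_alpha (projT2 x)) (cf_alpha (projT1 x)) erefl).
pose k (x : B) : A := existT (fun p => comp_factor (Mor (cf_beta p)))
  (@CompFactor C (Mor g) _ (comp (cf_beta (projT1 x)) (cf_beta (projT2 x)))
     (cf_alpha (projT2 x)) (kP _ (projT2 x)))
  (@CompFactor C (Mor (comp (cf_beta (projT1 x)) (cf_beta (projT2 x)))) _
     (cf_beta (projT1 x)) (cf_beta (projT2 x)) erefl).
rewrite -(@csum_reindex _ _ _ h k).
- by apply: eq_csum => -[p q] /=; rewrite mulrA.
- rewrite /h /k => -[[Z be al e] /= [W be' al' e']] /=.
  move: (kP _ _) => /= {hP kP h k}.
  move: be al e be' al' e' => /= be al e be' al' e'.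
  move: e; case: be / e' => e e'.
  by rewrite (Prop_irrelevance e' e).
- rewrite /h /k => -[[Z be al e] /= [W be' al' e']] /=.
  move: (hP _ _) => /= {hP kP h k}.
  move: be al e be' al' e' => /= be al e be' al' e'.
  move: e; case: al / e' => e e'.
  by rewrite (Prop_irrelevance e' e).
Qed.

Let is_id_src (X Z : ob C) (f : hom X Z) (P : forall Z, hom X Z -> Prop) :
  (exists W, Mor f = Mor (idm W)) -> P X (idm X) -> P Z f.
Proof.
move=> [W e] PX.
suff H : forall (m : mor C) (e : src m = X), m = Mor (idm W) ->
    P (tgt m) (eq_rect _ (fun X => hom X (tgt m)) (arr m) _ e).
  exact: (H (Mor f) erefl e).
by move=> m em E; move: em; rewrite E /= => em; subst X.
Qed.

Let is_id_tgt (Z Y : ob C) (f : hom Z Y) (P : forall Z, hom Z Y -> Prop) :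
  (exists W, Mor f = Mor (idm W)) -> P Y (idm Y) -> P Z f.
Proof.
move=> [W e] PX.
suff H : forall (m : mor C) (e : tgt m = Y), m = Mor (idm W) ->
    P (src m) (eq_rect _ (fun Y => hom (src m) Y) (arr m) _ e).
  exact: (H (Mor f) erefl e).
by move=> m em E; move: em; rewrite E /= => em; subst Y.
Qed.

Let qc_mul1 : left_id qc_one qc_mul.
Proof.
move=> a; apply/funext => -[X Y g]; rewrite /qc_mul.
rewrite (csum_support1 (i0 := @CompFactor C (Mor g) _ g (idm X) (compm1 g))).
  rewrite /= /qc_one; case: asboolP => [_|[]]; first by rewrite mulr1.
  by exists X.
move=> [Z be al e] /= ne; rewrite /qc_one; case: asboolP => [|_]; last first.
  by rewrite mulr0.
move=> idal; exfalso; move: be e ne.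
apply: (is_id_src (P := fun Z al => forall (be : hom Z Y)
  (e : comp be al = g), CompFactor (gamma := Mor g) be al e <> _ -> False) idal).
move=> be e; have ebe : be = g by rewrite -e compm1.
by subst be; apply; rewrite (Prop_irrelevance e (compm1 g)).
Qed.

Let qc_mulr1 : right_id qc_one qc_mul.
Proof.
move=> a; apply/funext => -[X Y g]; rewrite /qc_mul.
rewrite (csum_support1 (i0 := @CompFactor C (Mor g) _ (idm Y) g (comp1m g))).
  rewrite /= /qc_one; case: asboolP => [_|[]]; first by rewrite mul1r.
  by exists Y.
move=> [Z be al e] /= ne; rewrite /qc_one; case: asboolP => [|_]; last first.
  by rewrite mul0r.
move=> idbe; exfalso; move: al e ne.
apply: (is_id_tgt (P := fun Z be => forall (al : hom X Z)
  (e : comp be al = g), CompFactor (gamma := Mor g) be al e <> _ -> False) idbe).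
move=> al e; have eal : al = g by rewrite -e comp1m.
by subst al; apply; rewrite (Prop_irrelevance e (comp1m g)).
Qed.

Let qc_mulDl : left_distributive qc_mul +%R.
Proof.
move=> a b c; apply/funext => gamma; rewrite /qc_mul -[RHS]csumD.
by apply: eq_csum => p; rewrite -mulrDr.
Qed.

Let qc_mulDr : right_distributive qc_mul +%R.
Proof.
move=> a b c; apply/funext => gamma; rewrite /qc_mul -[RHS]csumD.
by apply: eq_csum => p; rewrite -mulrDl.
Qed.

Let qc_mul0 : left_zero 0 qc_mul.
Proof.
move=> a; apply/funext => gamma; rewrite /qc_mul -[RHS](csum0 S (comp_factor gamma)).
by apply: eq_csum => p; rewrite mulr0.
Qed.

Let qc_mulr0 : right_zero 0 qc_mul.
Proof.
move=> a; apply/funext => gamma; rewrite /qc_mul -[RHS](csum0 S (comp_factor gamma)).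
by apply: eq_csum => p; rewrite mul0r.
Qed.

HB.instance Definition _ := GRing.Nmodule_isPzSemiRing.Build (Qc S C)
  qc_mulA qc_mul1 qc_mulr1 qc_mulDl qc_mulDr qc_mul0 qc_mulr0.

End CompositionSemiring.

Section MonoidalSemiring.
Variables (S : completeSemiRingType) (C : strictMonoidalCategory).

HB.instance Definition _ := GRing.Nmodule.copy (Qm S C) (mor C -> S).

Definition qm_one : Qm S C :=
  fun gamma => if `[< gamma = Mor (idm (unit_ob C)) >] then 1 else 0.

Definition qm_mul (a b : Qm S C) : Qm S C := fun gamma =>
  csum (fun p : tensor_factor gamma => b (tf_beta p) * a (tf_alpha p)).

Let tensor_morA : associative (@tensor_mor C).
Proof. by move=> f g h; rewrite /tensor_mor tensor_homA. Qed.

Let tensor_mor1m (f : mor C) : tensor_mor (Mor (idm (unit_ob C))) f = f.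
Proof. by case: f => X Y f; rewrite /tensor_mor tensor_hom1m. Qed.

Let tensor_morm1 (f : mor C) : tensor_mor f (Mor (idm (unit_ob C))) = f.
Proof. by case: f => X Y f; rewrite /tensor_mor tensor_homm1. Qed.

Let qm_mulA : associative qm_mul.
Proof.
move=> a b c; apply/funext => gamma; rewrite /qm_mul.
under eq_csum do rewrite -csum_mull.
under [RHS]eq_csum do rewrite -csum_mulr.
rewrite !csum_sig.
pose A := {p : tensor_factor gamma & tensor_factor (tf_beta p)}.
pose B := {p : tensor_factor gamma & tensor_factor (tf_alpha p)}.
have hP (p : tensor_factor gamma) (q : tensor_factor (tf_beta p)) :
    tensor_mor (tensor_mor (tf_alpha p) (tf_alpha q)) (tf_beta q) = gamma.
  by rewrite -tensor_morA (tf_eq q) (tf_eq p).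
have kP (p : tensor_factor gamma) (q : tensor_factor (tf_alpha p)) :
    tensor_mor (tf_alpha q) (tensor_mor (tf_beta q) (tf_beta p)) = gamma.
  by rewrite tensor_morA (tf_eq q) (tf_eq p).
pose h (x : A) : B := existT (fun p => tensor_factor (tf_alpha p))
  (TensorFactor (tensor_mor (tf_alpha (projT1 x)) (tf_alpha (projT2 x)))
     (tf_beta (projT2 x)) (hP _ (projT2 x)))
  (TensorFactor (tf_alpha (projT1 x)) (tf_alpha (projT2 x)) erefl).
pose k (x : B) : A := existT (fun p => tensor_factor (tf_beta p))
  (TensorFactor (tf_alpha (projT2 x))
     (tensor_mor (tf_beta (projT2 x)) (tf_beta (projT1 x))) (kP _ (projT2 x)))
  (TensorFactor (tf_beta (projT2 x)) (tf_beta (projT1 x)) erefl).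
rewrite -(@csum_reindex _ _ _ h k).
- by apply: eq_csum => -[p q] /=; rewrite mulrA.
- rewrite /h /k => -[[al be e] /= [al' be' e']] /=.
  move: (kP _ _) => /= {hP kP h k}.
  move: be al e be' al' e' => /= be al e be' al' e'.
  move: e; case: be / e' => e e'.
  by rewrite (Prop_irrelevance e' e).
- rewrite /h /k => -[[al be e] /= [al' be' e']] /=.
  move: (hP _ _) => /= {hP kP h k}.
  move: be al e be' al' e' => /= be al e be' al' e'.
  move: e; case: al / e' => e e'.
  by rewrite (Prop_irrelevance e' e).
Qed.

Let qm_mul1 : left_id qm_one qm_mul.
Proof.
move=> a; apply/funext => g; rewrite /qm_mul.
rewrite (csum_support1 (i0 := TensorFactor _ _ (tensor_mor1m g))).
  by rewrite /= /qm_one; case: asboolP => // _; rewrite mulr1.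
move=> [al be e] /= ne; rewrite /qm_one; case: asboolP => [eal|_]; last first.
  by rewrite mulr0.
exfalso; apply: ne; subst al.
have ebe : be = g by rewrite -e tensor_mor1m.
by subst be; rewrite (Prop_irrelevance e (tensor_mor1m g)).
Qed.

Let qm_mulr1 : right_id qm_one qm_mul.
Proof.
move=> a; apply/funext => g; rewrite /qm_mul.
rewrite (csum_support1 (i0 := TensorFactor _ _ (tensor_morm1 g))).
  by rewrite /= /qm_one; case: asboolP => // _; rewrite mul1r.
move=> [al be e] /= ne; rewrite /qm_one; case: asboolP => [ebe|_]; last first.
  by rewrite mul0r.
exfalso; apply: ne; subst be.
have eal : al = g by rewrite -e tensor_morm1.
by subst al; rewrite (Prop_irrelevance e (tensor_morm1 g)).
Qed.

Let qm_mulDl : left_distributive qm_mul +%R.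
Proof.
move=> a b c; apply/funext => gamma; rewrite /qm_mul -[RHS]csumD.
by apply: eq_csum => p; rewrite -mulrDr.
Qed.

Let qm_mulDr : right_distributive qm_mul +%R.
Proof.
move=> a b c; apply/funext => gamma; rewrite /qm_mul -[RHS]csumD.
by apply: eq_csum => p; rewrite -mulrDl.
Qed.

Let qm_mul0 : left_zero 0 qm_mul.
Proof.
move=> a; apply/funext => gamma; rewrite /qm_mul -[RHS](csum0 S (tensor_factor gamma)).
by apply: eq_csum => p; rewrite mulr0.
Qed.

Let qm_mulr0 : right_zero 0 qm_mul.
Proof.
move=> a; apply/funext => gamma; rewrite /qm_mul -[RHS](csum0 S (tensor_factor gamma)).
by apply: eq_csum => p; rewrite mul0r.
Qed.

HB.instance Definition _ := GRing.Nmodule_isPzSemiRing.Build (Qm S C)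
  qm_mulA qm_mul1 qm_mulr1 qm_mulDl qm_mulDr qm_mul0 qm_mulr0.

End MonoidalSemiring.

(* MathComp's [lSemiModType] and [lSemiAlgType] have no right action, and the
   latter requires 1 != 0. *)
HB.mixin Record Nmodule_isBiSemiModule (R : pzSemiRingType) V
    of GRing.Nmodule V := {
  lscale : R -> V -> V;
  rscale : V -> R -> V;
  lscaleA : forall (r s : R) (v : V), lscale r (lscale s v) = lscale (r * s) v;
  lscale0 : forall v : V, lscale 0 v = 0;
  lscale1 : forall v : V, lscale 1 v = v;
  lscaler0 : forall r : R, lscale r 0 = 0;
  lscaleDr : forall (r : R) (u v : V),
    lscale r (u + v) = lscale r u + lscale r v;
  lscaleDl : forall (r s : R) (v : V),
    lscale (r + s) v = lscale r v + lscale s v;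
  rscaleA : forall (v : V) (r s : R), rscale (rscale v r) s = rscale v (r * s);
  rscale0 : forall v : V, rscale v 0 = 0;
  rscale1 : forall v : V, rscale v 1 = v;
  rscale0r : forall r : R, rscale 0 r = 0;
  rscaleDl : forall (u v : V) (r : R),
    rscale (u + v) r = rscale u r + rscale v r;
  rscaleDr : forall (v : V) (r s : R),
    rscale v (r + s) = rscale v r + rscale v s;
  lscale_rscale : forall (r s : R) (v : V),
    rscale (lscale r v) s = lscale r (rscale v s)
}.

#[short(type="biSemiModType")]
HB.structure Definition BiSemiModule (R : pzSemiRingType) :=
  {V of GRing.Nmodule V & Nmodule_isBiSemiModule R V}.

HB.mixin Record BiSemiModule_isTwoSidedSemiAlgebra (R : pzSemiRingType) A
    of GRing.PzSemiRing A & BiSemiModule R A := {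
  lscale_mul : forall (r : R) (a b : A), lscale r (a * b) = lscale r a * b;
  mul_rscale : forall (r : R) (a b : A), rscale (a * b) r = a * rscale b r
}.

#[short(type="twoSidedSemiAlgType")]
HB.structure Definition TwoSidedSemiAlgebra (R : pzSemiRingType) :=
  {A of GRing.PzSemiRing A & BiSemiModule R A
      & BiSemiModule_isTwoSidedSemiAlgebra R A}.

Definition semialg_morphism (R : pzSemiRingType) (A B : twoSidedSemiAlgType R)
    (f : A -> B) : Prop :=
  [/\ nmod_morphism f, monoid_morphism f,
      forall (r : R) (a : A), f (lscale r a) = lscale r (f a)
    & forall (a : A) (r : R), f (rscale a r) = rscale (f a) r].

Definition semialg_isomorphism (R : pzSemiRingType)
    (A B : twoSidedSemiAlgType R) (f : A -> B) : Prop :=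
  semialg_morphism f /\
  exists g : B -> A, [/\ semialg_morphism g, cancel f g & cancel g f].

Definition Fun (R : pzSemiRingType) (A : Type) : Type := A -> R.

Section FunSemiAlgebra.
Variables (R : pzSemiRingType) (A : Type).

HB.instance Definition _ := GRing.Nmodule.copy (Fun R A) (A -> R).

Definition fun_one : Fun R A := fun _ => 1.
Definition fun_mul (f g : Fun R A) : Fun R A := fun x => f x * g x.
Definition fun_lscale (r : R) (f : Fun R A) : Fun R A := fun x => r * f x.
Definition fun_rscale (f : Fun R A) (r : R) : Fun R A := fun x => f x * r.

Let fun_mulA : associative fun_mul.
Proof. by move=> f g h; apply/funext => x; exact: mulrA. Qed.
Let fun_mul1 : left_id fun_one fun_mul.
Proof. by move=> f; apply/funext => x; exact: mul1r. Qed.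
Let fun_mulr1 : right_id fun_one fun_mul.
Proof. by move=> f; apply/funext => x; exact: mulr1. Qed.
Let fun_mulDl : left_distributive fun_mul +%R.
Proof. by move=> f g h; apply/funext => x; exact: mulrDl. Qed.
Let fun_mulDr : right_distributive fun_mul +%R.
Proof. by move=> f g h; apply/funext => x; exact: mulrDr. Qed.
Let fun_mul0 : left_zero 0 fun_mul.
Proof. by move=> f; apply/funext => x; exact: mul0r. Qed.
Let fun_mulr0 : right_zero 0 fun_mul.
Proof. by move=> f; apply/funext => x; exact: mulr0. Qed.

HB.instance Definition _ := GRing.Nmodule_isPzSemiRing.Build (Fun R A)
  fun_mulA fun_mul1 fun_mulr1 fun_mulDl fun_mulDr fun_mul0 fun_mulr0.

Let fun_lscaleA r s f : fun_lscale r (fun_lscale s f) = fun_lscale (r * s) f.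
Proof. by apply/funext => x; exact: mulrA. Qed.
Let fun_lscale0 f : fun_lscale 0 f = 0.
Proof. by apply/funext => x; exact: mul0r. Qed.
Let fun_lscale1 f : fun_lscale 1 f = f.
Proof. by apply/funext => x; exact: mul1r. Qed.
Let fun_lscaler0 r : fun_lscale r 0 = 0.
Proof. by apply/funext => x; exact: mulr0. Qed.
Let fun_lscaleDr r f g :
  fun_lscale r (f + g) = fun_lscale r f + fun_lscale r g.
Proof. by apply/funext => x; exact: mulrDr. Qed.
Let fun_lscaleDl r s f :
  fun_lscale (r + s) f = fun_lscale r f + fun_lscale s f.
Proof. by apply/funext => x; exact: mulrDl. Qed.
Let fun_rscaleA f r s : fun_rscale (fun_rscale f r) s = fun_rscale f (r * s).
Proof. by apply/funext => x; exact/esym/mulrA. Qed.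
Let fun_rscale0 f : fun_rscale f 0 = 0.
Proof. by apply/funext => x; exact: mulr0. Qed.
Let fun_rscale1 f : fun_rscale f 1 = f.
Proof. by apply/funext => x; exact: mulr1. Qed.
Let fun_rscale0r r : fun_rscale 0 r = 0.
Proof. by apply/funext => x; exact: mul0r. Qed.
Let fun_rscaleDl f g r :
  fun_rscale (f + g) r = fun_rscale f r + fun_rscale g r.
Proof. by apply/funext => x; exact: mulrDl. Qed.
Let fun_rscaleDr f r s :
  fun_rscale f (r + s) = fun_rscale f r + fun_rscale f s.
Proof. by apply/funext => x; exact: mulrDr. Qed.
Let fun_lscale_rscale r s f :
  fun_rscale (fun_lscale r f) s = fun_lscale r (fun_rscale f s).
Proof. by apply/funext => x; exact/esym/mulrA. Qed.

HB.instance Definition _ := Nmodule_isBiSemiModule.Build R (Fun R A)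
  fun_lscaleA fun_lscale0 fun_lscale1 fun_lscaler0 fun_lscaleDr fun_lscaleDl
  fun_rscaleA fun_rscale0 fun_rscale1 fun_rscale0r fun_rscaleDl fun_rscaleDr
  fun_lscale_rscale.

Let fun_lscale_mul r (f g : Fun R A) : fun_lscale r (f * g) = fun_lscale r f * g.
Proof. by apply/funext => x; exact: mulrA. Qed.
Let fun_mul_rscale r (f g : Fun R A) : fun_rscale (f * g) r = f * fun_rscale g r.
Proof. by apply/funext => x; exact/esym/mulrA. Qed.

HB.instance Definition _ := BiSemiModule_isTwoSidedSemiAlgebra.Build R (Fun R A)
  fun_lscale_mul fun_mul_rscale.

End FunSemiAlgebra.

Definition fun_pullback (R : pzSemiRingType) (A B : Type) (phi : A -> B)
  (z : Fun R B) : Fun R A := fun x => z (phi x).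

Definition fun_tensor (R : pzSemiRingType) (A B : Type) : Type :=
  Fun R (A * B).

HB.instance Definition _ (R : pzSemiRingType) (A B : Type) :=
  TwoSidedSemiAlgebra.copy (fun_tensor R A B) (Fun R (A * B)).

Section SumTopology.
Variables X Y : topologicalType.

Definition sum_nbhs (x : X + Y) : set_system (X + Y)%type :=
  match x with inl x => inl @ nbhs x | inr y => inr @ nbhs y end.

HB.instance Definition _ := hasNbhs.Build (X + Y)%type sum_nbhs.

Let sum_nbhs_proper (x : X + Y) : ProperFilter (sum_nbhs x).
Proof. by case: x => x; exact: fmap_proper_filter. Qed.

Let sum_nbhs_singleton (x : X + Y) A : sum_nbhs x A -> A x.
Proof. by case: x => x /= /nbhs_singleton. Qed.

Let sum_nbhs_nbhs (x : X + Y) A : sum_nbhs x A -> sum_nbhs x (sum_nbhs^~ A).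
Proof. by case: x => x /=; exact: nbhs_interior. Qed.

HB.instance Definition _ := Nbhs_isNbhsTopological.Build (X + Y)%type
  sum_nbhs_proper sum_nbhs_singleton sum_nbhs_nbhs.

Lemma sum_openP (A : set (X + Y)) :
  open A <-> open (inl @^-1` A) /\ open (inr @^-1` A).
Proof.
split=> [oA|[ol or]]; first by split; move: oA; rewrite !openE => oA x /oA.
by rewrite openE => -[x|y] Axy; [apply: (open_nbhs_nbhs (conj ol Axy))
  |apply: (open_nbhs_nbhs (conj or Axy))].
Qed.

Lemma inl_continuous : continuous (@inl X Y).
Proof. by apply/continuousP => A /sum_openP[]. Qed.

Lemma inr_continuous : continuous (@inr X Y).
Proof. by apply/continuousP => A /sum_openP[]. Qed.

Lemma inl_preimage_inl (A : set X) : inl @^-1` (@inl X Y @` A) = A.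
Proof. by apply/seteqP; split=> [x [x' Ax' [<-]]|x Ax] //; exists x. Qed.

Lemma inr_preimage_inr (A : set Y) : inr @^-1` (@inr X Y @` A) = A.
Proof. by apply/seteqP; split=> [x [x' Ax' [<-]]|x Ax] //; exists x. Qed.

Lemma inl_preimage_inr (A : set Y) : inl @^-1` (@inr X Y @` A) = set0.
Proof. by apply/seteqP; split=> x // -[]. Qed.

Lemma inr_preimage_inl (A : set X) : inr @^-1` (@inl X Y @` A) = set0.
Proof. by apply/seteqP; split=> x // -[]. Qed.

Lemma inl_open (A : set X) : open A -> open (@inl X Y @` A).
Proof.
move=> oA; apply/sum_openP; rewrite inr_preimage_inl inl_preimage_inl.
by split=> //; exact: open0.
Qed.

Lemma inr_open (A : set Y) : open A -> open (@inr X Y @` A).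
Proof.
move=> oA; apply/sum_openP; rewrite inl_preimage_inr inr_preimage_inr.
by split=> //; exact: open0.
Qed.

Lemma sum_compact : compact [set: X] -> compact [set: Y] ->
  compact [set: X + Y].
Proof.
move=> cX cY.
have -> : [set: X + Y] = inl @` [set: X] `|` inr @` [set: Y].
  by apply/seteqP; split=> -[x|y] // _; [left; exists x|right; exists y].
apply: compactU; apply: continuous_compact => //;
  apply: continuous_subspaceT; [exact: inl_continuous|exact: inr_continuous].
Qed.

Lemma nbhs_inl (x : X) (A : set X) : nbhs x A -> nbhs (inl x : X + Y)%type (inl @` A).
Proof. by move=> xA; rewrite /nbhs /= /nbhs /= inl_preimage_inl. Qed.

Lemma nbhs_inr (y : Y) (A : set Y) : nbhs y A -> nbhs (inr y : X + Y)%type (inr @` A).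
Proof. by move=> yA; rewrite /nbhs /= /nbhs /= inr_preimage_inr. Qed.

Lemma sum_hausdorff : hausdorff_space X -> hausdorff_space Y ->
  hausdorff_space (X + Y)%type.
Proof.
move=> hX hY [x|y] [x'|y'] cpq.
- congr inl; apply: hX => A B nA nB.
  have [_ [[a Aa <-] [b Bb [ba]]]] := cpq _ _ (nbhs_inl nA) (nbhs_inl nB).
  by exists a; split=> //; rewrite -ba.
- by have [_ [[a _ <-] [b _]]] :=
    cpq _ _ (nbhs_inl (nbhs_filter x).(filterT)) (nbhs_inr (nbhs_filter y').(filterT)).
- by have [_ [[a _ <-] [b _]]] :=
    cpq _ _ (nbhs_inr (nbhs_filter y).(filterT)) (nbhs_inl (nbhs_filter x').(filterT)).
- congr inr; apply: hY => A B nA nB.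
  have [_ [[a Aa <-] [b Bb [ba]]]] := cpq _ _ (nbhs_inr nA) (nbhs_inr nB).
  by exists a; split=> //; rewrite -ba.
Qed.

Lemma sum_second_countable : @second_countable X -> @second_countable Y ->
  @second_countable (X + Y)%type.
Proof.
move=> [A cA [oA bA]] [B cB [oB bB]].
exists ((fun U => inl @` U) @` A `|` (fun U => inr @` U) @` B).
  rewrite -bigcup2E; apply: bigcup_countable; first exact: countableP.
  by move=> [|[|k]] _ /=; [exact: sub_countable (card_image_le _ _) cA
    |exact: sub_countable (card_image_le _ _) cB|exact: countable0].
split=> [_ [[U AU <-]|[U BU <-]]|[x|y] N /= nN].
- by apply: inl_open; exact: oA.
- by apply: inr_open; exact: oB.
- have [U [AU Ux] UN] := bA x _ nN.
  by exists (inl @` U) => [|_ [u Uu <-]]; [split; [left; exists U|exists x]|exact: UN].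
- have [U [BU Uy] UN] := bB y _ nN.
  by exists (inr @` U) => [|_ [u Uu <-]]; [split; [right; exists U|exists y]|exact: UN].
Qed.

End SumTopology.

(* X carries the topology induced from Y, i.e. f is a homeomorphism onto its
   image. *)
Record embedding (X Y : topologicalType) := Embedding {
  emb_fun :> X -> Y;
  emb_inj : injective emb_fun;
  emb_open : forall A : set X,
    open A <-> exists2 B : set Y, open B & A = emb_fun @^-1` B
}.

Record homeo (X Y : topologicalType) := Homeo {
  homeo_fun :> X -> Y;
  homeo_inv : Y -> X;
  homeo_continuous : continuous homeo_fun;
  homeo_inv_continuous : continuous homeo_inv;
  homeo_funK : cancel homeo_fun homeo_inv;
  homeo_invK : cancel homeo_inv homeo_fun
}.

Section SumEmbedding.
Variables X Y X' Y' : topologicalType.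

Let inl_emb_open (A : set X) :
  open A <-> exists2 B : set (X + Y), open B & A = inl @^-1` B.
Proof.
split=> [oA|[B /sum_openP[oB _] ->]] //.
by exists (inl @` A); [exact: inl_open|rewrite inl_preimage_inl].
Qed.

Definition inl_emb : embedding X (X + Y)%type :=
  Embedding (fun x y (e : inl x = inl y) => inl_inj e) inl_emb_open.

Let inr_emb_open (A : set Y) :
  open A <-> exists2 B : set (X + Y), open B & A = inr @^-1` B.
Proof.
split=> [oA|[B /sum_openP[_ oB] ->]] //.
by exists (inr @` A); [exact: inr_open|rewrite inr_preimage_inr].
Qed.

Definition inr_emb : embedding Y (X + Y)%type :=
  Embedding (fun x y (e : inr x = inr y) => inr_inj e) inr_emb_open.

Variables (i : embedding X X') (j : embedding Y Y').

Definition sum_emb_fun (x : X + Y) : X' + Y' :=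
  match x with inl x => inl (i x) | inr y => inr (j y) end.

Let sum_emb_inj : injective sum_emb_fun.
Proof.
by move=> [x|x] [y|y] //= []; [move/(@emb_inj _ _ i)->|move/(@emb_inj _ _ j)->].
Qed.

Let sum_emb_open (A : set (X + Y)) :
  open A <-> exists2 B : set (X' + Y'), open B & A = sum_emb_fun @^-1` B.
Proof.
split=> [/sum_openP[/(emb_open i)[B oB eB] /(emb_open j)[D oD eD]]|].
  exists (inl @` B `|` inr @` D); first by apply: openU; [exact: inl_open|exact: inr_open].
  apply/seteqP; split=> -[x|y] /=.
  + by move=> Ax; left; exists (i x) => //; have : (i @^-1` B) x by rewrite -eB.
  + by move=> Ay; right; exists (j y) => //; have : (j @^-1` D) y by rewrite -eD.
  + move=> [[b Bb [bx]]|[]//]; have : (i @^-1` B) x by rewrite /= -bx.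
    by rewrite -eB.
  + move=> [[]//|[d Dd [dy]]]; have : (j @^-1` D) y by rewrite /= -dy.
    by rewrite -eD.
move=> [B /sum_openP[oB oD] ->]; apply/sum_openP; split.
  by apply/(emb_open i); exists (inl @^-1` B).
by apply/(emb_open j); exists (inr @^-1` B).
Qed.

Definition sum_emb : embedding (X + Y)%type (X' + Y')%type :=
  Embedding sum_emb_inj sum_emb_open.

End SumEmbedding.

(* f restricts to a homeomorphism of the open set U onto a relatively open
   subset of the model space H; its values outside U are irrelevant. *)
Definition is_chart (R : realType) (m : nat) (H : set 'rV[R]_m)
    (X : topologicalType) (U : set X) (f : X -> 'rV[R]_m) : Prop :=
  [/\ open U, {in U &, injective f}, {in U, continuous f}
    & forall A : set X, open A -> A `<=` U ->
      exists2 B : set 'rV[R]_m, open B & f @` A = B `&` H].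

Definition locally_modelled (R : realType) (m : nat) (H : set 'rV[R]_m)
    (X : topologicalType) : Prop :=
  forall x : X, exists (U : set X) (f : X -> 'rV[R]_m), U x /\ is_chart H U f.

Definition half_space (R : realType) (n : nat) : set 'rV[R]_n.+1 :=
  [set v | 0 <= v ord0 ord0].

Definition boundary (R : realType) (n : nat) (X : topologicalType) : set X :=
  [set x | exists (U : set X) (f : X -> 'rV[R]_n.+1),
    [/\ U x, is_chart (@half_space R n) U f & f x ord0 ord0 = 0]].

Arguments boundary R n X : clear implicits.

Section ChartTransfer.
Variables (R : realType) (m : nat) (H : set 'rV[R]_m) (X Z : topologicalType).
Variable j : X -> Z.
Hypotheses (jI : injective j) (jC : continuous j).
Hypothesis jO : forall A : set X, open A -> open (j @` A).

Lemma chart_pull (U : set Z) (f : Z -> 'rV[R]_m) :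
  is_chart H U f -> is_chart H (j @^-1` U) (f \o j).
Proof.
move=> [oU fI fC fO]; split.
- by apply: open_comp => // x _; exact: jC.
- move=> x y; rewrite !inE => Ux Uy e; apply: jI; apply: fI => //; exact: mem_set.
- move=> x; rewrite inE => Ux; apply: continuous_comp; first exact: jC.
  by apply: fC; exact: mem_set.
- move=> A oA AU; rewrite -image_comp; apply: fO; first exact: jO.
  by move=> _ [x Ax <-]; exact: AU.
Qed.

Lemma chart_push (U : set X) (f : Z -> 'rV[R]_m) :
  is_chart H U (f \o j) -> is_chart H (j @` U) f.
Proof.
move=> [oU fI fC fO]; split.
- exact: jO.
- move=> _ _ /set_mem[x Ux <-] /set_mem[y Uy <-] e; congr j.
  by apply: fI => //; exact: mem_set.
- move=> _ /set_mem[x Ux <-] N /(fC x (mem_set Ux)) /= nN.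
  rewrite nbhsE in nN; case: nN => B [oB Bx] BN.
  rewrite nbhs_simpl /= nbhsE; exists (j @` B); first by split; [exact: jO|exists x].
  by move=> _ [b Bb <-]; exact: BN.
- move=> A oA AU; have oA' : open (j @^-1` A).
    by apply: open_comp => // x _; exact: jC.
  have AE : A = j @` (j @^-1` A).
    apply/seteqP; split=> [z Az|_ [x Ax <-]] //.
    by have [x _ xz] := AU _ Az; exists x => //=; rewrite xz.
  rewrite {1}AE image_comp; apply: fO => // x Ax.
  by have [y Uy /jI <-] := AU _ Ax.
Qed.

End ChartTransfer.

Section SumCharts.
Variables (R : realType) (m : nat) (H : set 'rV[R]_m) (X Y : topologicalType).

Definition extend_l (f : X -> 'rV[R]_m) (z : X + Y) : 'rV[R]_m :=
  if z is inl x then f x else 0.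

Definition extend_r (f : Y -> 'rV[R]_m) (z : X + Y) : 'rV[R]_m :=
  if z is inr y then f y else 0.

Lemma chart_extend_l (U : set X) (f : X -> 'rV[R]_m) :
  is_chart H U f -> is_chart H (inl @` U) (extend_l f).
Proof.
move=> cf; apply: (chart_push (@inl_inj X Y)) => //.
- exact: inl_continuous.
- exact: inl_open.
Qed.

Lemma chart_extend_r (U : set Y) (f : Y -> 'rV[R]_m) :
  is_chart H U f -> is_chart H (inr @` U) (extend_r f).
Proof.
move=> cf; apply: (chart_push (@inr_inj X Y)) => //.
- exact: inr_continuous.
- exact: inr_open.
Qed.

Lemma sum_locally_modelled : locally_modelled H X -> locally_modelled H Y ->
  locally_modelled H (X + Y)%type.
Proof.
move=> hX hY [x|y].
  have [U [f [Ux cf]]] := hX x; exists (inl @` U), (extend_l f).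
  by split; [exists x|exact: chart_extend_l].
have [U [f [Uy cf]]] := hY y; exists (inr @` U), (extend_r f).
by split; [exists y|exact: chart_extend_r].
Qed.

End SumCharts.

Lemma sum_boundary (R : realType) (n : nat) (X Y : topologicalType) :
  boundary R n (X + Y)%type = inl @` boundary R n X `|` inr @` boundary R n Y.
Proof.
apply/seteqP; split=> [[x|y] [U [f [Ux cf f0]]]|_ [] [x [U [f [Ux cf f0]]] <-]].
- left; exists x => //; exists (inl @^-1` U), (f \o inl); split=> //.
  exact: (chart_pull (@inl_inj X Y) (@inl_continuous X Y) (@inl_open X Y) cf).
- right; exists y => //; exists (inr @^-1` U), (f \o inr); split=> //.
  exact: (chart_pull (@inr_inj X Y) (@inr_continuous X Y) (@inr_open X Y) cf).
- exists (inl @` U), (extend_l f); split=> //.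
  exact: chart_extend_l.
- exists (inr @` U), (extend_r f); split=> //.
  exact: chart_extend_r.
Qed.

Record closedManifold (R : realType) (n : nat) := ClosedManifold {
  cm_space :> topologicalType;
  cm_compact : compact [set: cm_space];
  cm_hausdorff : hausdorff_space cm_space;
  cm_second_countable : @second_countable cm_space;
  cm_charts : locally_modelled [set: 'rV[R]_n] cm_space
}.

Definition cm_sum (R : realType) (n : nat) (M N : closedManifold R n) :
    closedManifold R n :=
  ClosedManifold
    (sum_compact (@cm_compact _ _ M) (@cm_compact _ _ N))
    (sum_hausdorff (@cm_hausdorff _ _ M) (@cm_hausdorff _ _ N))
    (sum_second_countable (@cm_second_countable _ _ M) (@cm_second_countable _ _ N))
    (sum_locally_modelled (@cm_charts _ _ M) (@cm_charts _ _ N)).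

(* The triples (W, M, N): the identification of the boundary of W with the
   disjoint union of M and N is given by two embeddings with disjoint images. *)
Record bordism (R : realType) (n : nat) (M N : closedManifold R n) := Bordism {
  bd_space :> topologicalType;
  bd_compact : compact [set: bd_space];
  bd_hausdorff : hausdorff_space bd_space;
  bd_second_countable : @second_countable bd_space;
  bd_charts : locally_modelled (@half_space R n) bd_space;
  bd_in : embedding M bd_space;
  bd_out : embedding N bd_space;
  bd_disjoint : range bd_in `&` range bd_out = set0;
  bd_boundary : boundary R n bd_space = range bd_in `|` range bd_out
}.

Section BordismSum.
Variables (R : realType) (n : nat) (M N M' N' : closedManifold R n).
Variables (W : bordism M N) (W' : bordism M' N').

Let sum_in : embedding (cm_sum M M') (W + W')%type :=
  sum_emb (bd_in W) (bd_in W').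
Let sum_out : embedding (cm_sum N N') (W + W')%type :=
  sum_emb (bd_out W) (bd_out W').

Let sum_disjoint : range sum_in `&` range sum_out = set0.
Proof.
apply/seteqP; split=> // _ [[[x|x] _ <-] [[y|y] _]] //= [e].
  suff : (range (bd_in W) `&` range (bd_out W)) (bd_in W x).
    by rewrite bd_disjoint.
  by split; [exists x|exists y].
suff : (range (bd_in W') `&` range (bd_out W')) (bd_in W' x).
  by rewrite bd_disjoint.
by split; [exists x|exists y].
Qed.

Let sum_bd : boundary R n (W + W')%type = range sum_in `|` range sum_out.
Proof.
rewrite sum_boundary !bd_boundary.
apply/seteqP; split=> [_ [[_ [[x _ <-]|[x _ <-]] <-]|[_ [[x _ <-]|[x _ <-]] <-]]|].
- by left; exists (inl x).
- by right; exists (inl x).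
- by left; exists (inr x).
- by right; exists (inr x).
move=> _ [[[x|x] _ <-]|[[x|x] _ <-]].
- by left; exists (bd_in W x) => //; left; exists x.
- by right; exists (bd_in W' x) => //; left; exists x.
- by left; exists (bd_out W x) => //; right; exists x.
- by right; exists (bd_out W' x) => //; right; exists x.
Qed.

Definition bd_sum : bordism (cm_sum M M') (cm_sum N N') :=
  Bordism
    (sum_compact (@bd_compact _ _ _ _ W) (@bd_compact _ _ _ _ W'))
    (sum_hausdorff (@bd_hausdorff _ _ _ _ W) (@bd_hausdorff _ _ _ _ W'))
    (sum_second_countable (@bd_second_countable _ _ _ _ W) (@bd_second_countable _ _ _ _ W'))
    (sum_locally_modelled (@bd_charts _ _ _ _ W) (@bd_charts _ _ _ _ W'))
    sum_disjoint sum_bd.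

End BordismSum.

Record bordism_homeo (R : realType) (n : nat) (M N M' N' : closedManifold R n)
    (W : bordism M N) (W' : bordism M' N') := BordismHomeo {
  bh_homeo :> homeo W W';
  bh_in : bh_homeo @` range (bd_in W) = range (bd_in W');
  bh_out : bh_homeo @` range (bd_out W) = range (bd_out W')
}.

(* Submanifolds are given by their inclusions; W0 having the dimension of W, an
   embedding of W0 has codimension 0. *)
Record subbordism (R : realType) (n : nat) (M0 N0 M N : closedManifold R n)
    (W0 : bordism M0 N0) (W : bordism M N) := Subbordism {
  sb_emb :> embedding W0 W;
  sb_in : forall x : M0,
    let C := sb_emb @` (bd_in W0 @` connected_component [set: M0] x) in
    C `&` boundary R n W = set0 \/ C `<=` range (bd_in W);
  sb_out : forall y : N0,
    let C := sb_emb @` (bd_out W0 @` connected_component [set: N0] y) in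
    C `&` boundary R n W = set0 \/ C `<=` range (bd_out W)
}.

Section SummandInclusions.
Variables (R : realType) (n : nat) (M N M' N' : closedManifold R n).

Definition cm_inl : embedding M (cm_sum M M') := inl_emb M M'.
Definition cm_inr : embedding M' (cm_sum M M') := inr_emb M M'.

Variables (W : bordism M N) (W' : bordism M' N').

Let inl_in (x : M) :
  let C := inl_emb W W' @` (bd_in W @` connected_component [set: M] x) in
  C `&` boundary R n (bd_sum W W') = set0 \/ C `<=` range (bd_in (bd_sum W W')).
Proof. by right=> _ [_ [y _ <-] <-]; exists (inl y). Qed.

Let inl_out (x : N) :
  let C := inl_emb W W' @` (bd_out W @` connected_component [set: N] x) in
  C `&` boundary R n (bd_sum W W') = set0 \/ C `<=` range (bd_out (bd_sum W W')).
Proof. by right=> _ [_ [y _ <-] <-]; exists (inl y). Qed.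

Definition bd_inl : subbordism W (bd_sum W W') :=
  @Subbordism R n M N _ _ W (bd_sum W W') (inl_emb W W') inl_in inl_out.

Let inr_in (x : M') :
  let C := inr_emb W W' @` (bd_in W' @` connected_component [set: M'] x) in
  C `&` boundary R n (bd_sum W W') = set0 \/ C `<=` range (bd_in (bd_sum W W')).
Proof. by right=> _ [_ [y _ <-] <-]; exists (inr y). Qed.

Let inr_out (x : N') :
  let C := inr_emb W W' @` (bd_out W' @` connected_component [set: N'] x) in
  C `&` boundary R n (bd_sum W W') = set0 \/ C `<=` range (bd_out (bd_sum W W')).
Proof. by right=> _ [_ [y _ <-] <-]; exists (inr y). Qed.

Definition bd_inr : subbordism W' (bd_sum W W') :=
  @Subbordism R n M' N' _ _ W' (bd_sum W W') (inr_emb W W') inr_in inr_out.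

End SummandInclusions.

(* Exhibits W as the gluing of W' and W'' along N.  All spaces being compact
   Hausdorff, W then carries the quotient topology. *)
Record gluing (R : realType) (n : nat) (M N P : closedManifold R n)
    (W' : bordism M N) (W'' : bordism N P) (W : bordism M P) := Gluing {
  gl_l : subbordism W' W;
  gl_r : subbordism W'' W;
  gl_cover : range gl_l `|` range gl_r = [set: W];
  gl_match : forall z : N, gl_l (bd_out W' z) = gl_r (bd_in W'' z);
  gl_meet : forall (x : W') (y : W''), gl_l x = gl_r y ->
    exists z : N, x = bd_out W' z /\ y = bd_in W'' z;
  gl_in : forall x : M, bd_in W x = gl_l (bd_in W' x);
  gl_out : forall y : P, bd_out W y = gl_r (bd_out W'' y)
}.

(* The letters B and M in the names stand for bordisms and closed manifolds.
   Since submanifolds are given by their inclusions, "restricting in stages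
   equals restricting directly" is stated whenever an inclusion k is the
   composite of inclusions j and i. *)
Record fieldSystem (R : realType) (n : nat) := FieldSystem {
  fieldB : forall M N : closedManifold R n, bordism M N -> Type;
  fieldM : closedManifold R n -> Type;
  fieldB_empty : forall (M N : closedManifold R n) (W : bordism M N),
    (W -> False) -> exists! f : fieldB W, True;
  fieldM_empty : forall M : closedManifold R n,
    (M -> False) -> exists! f : fieldM M, True;

  resBB : forall (M0 N0 M N : closedManifold R n)
    (W0 : bordism M0 N0) (W : bordism M N),
    subbordism W0 W -> fieldB W -> fieldB W0;
  resMM : forall M0 M : closedManifold R n,
    embedding M0 M -> fieldM M -> fieldM M0;
  resBM : forall (M N M0 : closedManifold R n) (W : bordism M N),
    embedding M0 W -> fieldB W -> fieldM M0;
  resBBB : forall (M0 N0 M1 N1 M N : closedManifold R n)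
    (W0 : bordism M0 N0) (W1 : bordism M1 N1) (W : bordism M N)
    (i : subbordism W0 W1) (j : subbordism W1 W) (k : subbordism W0 W),
    (forall x, k x = j (i x)) ->
    forall f, resBB i (resBB j f) = resBB k f;
  resMMM : forall (M0 M1 M : closedManifold R n)
    (i : embedding M0 M1) (j : embedding M1 M) (k : embedding M0 M),
    (forall x, k x = j (i x)) ->
    forall f, resMM i (resMM j f) = resMM k f;
  resBBM : forall (M1 N1 M N M0 : closedManifold R n)
    (W1 : bordism M1 N1) (W : bordism M N)
    (i : embedding M0 W1) (j : subbordism W1 W) (k : embedding M0 W),
    (forall x, k x = j (i x)) ->
    forall f, resBM i (resBB j f) = resBM k f;
  resBMM : forall (M N M0 M1 : closedManifold R n) (W : bordism M N)
    (i : embedding M0 M1) (j : embedding M1 W) (k : embedding M0 W),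
    (forall x, k x = j (i x)) ->
    forall f, resMM i (resBM j f) = resBM k f;

  pullB : forall (M N M' N' : closedManifold R n)
    (W : bordism M N) (W' : bordism M' N'),
    bordism_homeo W W' -> fieldB W' -> fieldB W;
  pullM : forall M M' : closedManifold R n,
    homeo M M' -> fieldM M' -> fieldM M;
  pullB_bij : forall (M N M' N' : closedManifold R n)
    (W : bordism M N) (W' : bordism M' N') (phi : bordism_homeo W W'),
    bijective (pullB phi);
  pullM_bij : forall (M M' : closedManifold R n) (phi : homeo M M'),
    bijective (pullM phi);
  pullB_id : forall (M N : closedManifold R n) (W : bordism M N)
    (phi : bordism_homeo W W), phi =1 id -> pullB phi =1 id;
  pullM_id : forall (M : closedManifold R n) (phi : homeo M M),
    phi =1 id -> pullM phi =1 id;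
  pullB_comp : forall (M N M' N' M'' N'' : closedManifold R n)
    (W : bordism M N) (W' : bordism M' N') (W'' : bordism M'' N'')
    (phi : bordism_homeo W W') (psi : bordism_homeo W' W'')
    (chi : bordism_homeo W W''),
    chi =1 psi \o phi -> pullB chi =1 pullB phi \o pullB psi;
  pullM_comp : forall (M M' M'' : closedManifold R n)
    (phi : homeo M M') (psi : homeo M' M'') (chi : homeo M M''),
    chi =1 psi \o phi -> pullM chi =1 pullM phi \o pullM psi;
  pullB_resBB : forall (M0 N0 M0' N0' M N M' N' : closedManifold R n)
    (W0 : bordism M0 N0) (W0' : bordism M0' N0')
    (W : bordism M N) (W' : bordism M' N')
    (i : subbordism W0 W) (i' : subbordism W0' W')
    (phi : bordism_homeo W W') (phi0 : bordism_homeo W0 W0'),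
    phi \o i =1 i' \o phi0 ->
    forall f, resBB i (pullB phi f) = pullB phi0 (resBB i' f);
  pullM_resMM : forall (M0 M0' M M' : closedManifold R n)
    (i : embedding M0 M) (i' : embedding M0' M')
    (phi : homeo M M') (phi0 : homeo M0 M0'),
    phi \o i =1 i' \o phi0 ->
    forall f, resMM i (pullM phi f) = pullM phi0 (resMM i' f);
  pullB_resBM : forall (M N M' N' M0 M0' : closedManifold R n)
    (W : bordism M N) (W' : bordism M' N')
    (i : embedding M0 W) (i' : embedding M0' W')
    (phi : bordism_homeo W W') (phi0 : homeo M0 M0'),
    phi \o i =1 i' \o phi0 ->
    forall f, resBM i (pullB phi f) = pullM phi0 (resBM i' f);

  fieldB_sum : forall (M N M' N' : closedManifold R n)
    (W : bordism M N) (W' : bordism M' N'),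
    bijective (fun f : fieldB (bd_sum W W') =>
      (resBB (bd_inl W W') f, resBB (bd_inr W W') f));
  fieldM_sum : forall M N : closedManifold R n,
    bijective (fun f : fieldM (cm_sum M N) =>
      (resMM (cm_inl M N) f, resMM (cm_inr M N) f));

  field_glue : forall (M N P : closedManifold R n)
    (W' : bordism M N) (W'' : bordism N P) (W : bordism M P)
    (g : gluing W' W'' W) (f' : fieldB W') (f'' : fieldB W''),
    resBM (bd_out W') f' = resBM (bd_in W'') f'' ->
    exists! f : fieldB W, resBB (gl_l g) f = f' /\ resBB (gl_r g) f = f''
}.

Definition isotopic_to_id (R : realType) (X : topologicalType)
    (phi : homeo X X) : Prop :=
  exists H : X * R -> X,
    [/\ {within [set: X] `*` [set` `[0, 1]%R], continuous H},
        forall x, H (x, 0) = x,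
        forall x, H (x, 1) = phi x
      & forall t : R, 0 <= t <= 1 ->
          exists h : homeo X X, forall x, H (x, t) = h x].

Section StateModule.
Variables (R : realType) (n : nat) (F : fieldSystem R n).
Implicit Types M N : closedManifold R n.

Definition field_equiv M (f g : fieldM F M) : Prop :=
  exists phi : homeo M M, isotopic_to_id R phi /\ g = pullM phi f.

Definition field_class M (f : fieldM F M) : set (fieldM F M) :=
  [set g | field_equiv f g].

Definition Fbar M : Type :=
  {c : set (fieldM F M) | exists f, c = field_class f}.

Definition fbar M (f : fieldM F M) : Fbar M :=
  exist _ (field_class f) (ex_intro _ f erefl).

(* Used with Q = Q^c and with Q = Q^m. *)
Definition state_module (Q : pzSemiRingType) M : twoSidedSemiAlgType Q :=
  Fun Q (Fbar M).

Definition state_tensor (Q : pzSemiRingType) M N : twoSidedSemiAlgType Q :=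
  fun_tensor Q (Fbar M) (Fbar N).

Definition state_pullback (Q : pzSemiRingType) M N
    (rho : Fbar (cm_sum M N) -> Fbar M * Fbar N) :
    state_tensor Q M N -> state_module Q (cm_sum M N) :=
  fun_pullback (R := Q) rho.

End StateModule.

(* Main.v *)
Require Import Defs.
From HB Require Import structures.
From mathcomp Require Import all_boot all_order all_algebra.
From mathcomp Require Import all_classical all_reals all_analysis.

Import Order.TTheory GRing.Theory Num.Theory.
Import numFieldNormedType.Exports.

Set Implicit Arguments.
Unset Strict Implicit.
Unset Printing Implicit Defensive.

Local Open Scope classical_set_scope.
Local Open Scope ring_scope.

(** The state module of [M] is the function semialgebra of the set of
    isotopy classes of fields on [M], and precomposition with a bijection is an
    isomorphism of function semialgebras, whatever the coefficient semiring
    ([fun_pullback_isomorphism]).  So both isomorphisms follow as soon as the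
    restrictions to the two summands induce a bijection from the isotopy classes
    of fields on the disjoint union onto the pairs of isotopy classes.

    On fields themselves the restriction map is a bijection ([fieldM_sum]).  To pass
    to isotopy classes one compares isotopies of the disjoint union with pairs of
    isotopies of the summands.
    - An isotopy from the identity moves each point along a path, and a path
      cannot leave a clopen set.  Each stage of the isotopy thus maps a summand
      onto itself, and the isotopy restricts to isotopies of the summands
      ([isotopic_to_id_restrict]).  By naturality of restriction the map on
      classes is well defined.
    - Two isotopies of the summands can be run side by side
      ([isotopic_to_id_sum]).  Since a field on the union is determined by its
      restrictions, fields with isotopic restrictions are isotopic, so the map on
      classes is injective.
    Surjectivity is inherited from the bijection on fields. *)

(** * Continuity within a subset *)

(** Unfolds the subspace topology into neighborhoods of the ambient space, where
    [filterS] applies. *)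
Lemma within_continuousP (X Y : topologicalType) (A : set X) (f : X -> Y) :
  {within A, continuous f} <->
  forall x, A x -> forall V, nbhs (f x) V -> nbhs x [set y | A y -> V (f y)].
Proof. exact: subspace_continuousP. Qed.

Lemma within_continuous_comp (X Y Z : topologicalType) (A : set X) (B : set Y)
    (g : X -> Y) (f : Y -> Z) :
  {homo g : x / A x >-> B x} ->
  {within A, continuous g} -> {within B, continuous f} ->
  {within A, continuous (f \o g)}.
Proof.
move=> gAB /within_continuousP cg /within_continuousP cf.
apply/within_continuousP => x Ax V /(cf _ (gAB _ Ax)) /(cg _ Ax).
by apply: filterS => y gV Ay; apply: gV => //; exact: gAB.
Qed.

Lemma within_continuous_eq (X Y : topologicalType) (A : set X) (f g : X -> Y) :
  (forall x, A x -> f x = g x) ->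
  {within A, continuous f} -> {within A, continuous g}.
Proof.
move=> fg /within_continuousP cf; apply/within_continuousP => x Ax V.
rewrite -fg // => /(cf _ Ax).
by apply: filterS => y fV Ay; rewrite -fg //; exact: fV.
Qed.

(** An embedding induces the topology of its source, so continuity can be tested
    after composing with it. *)
Lemma within_continuous_emb (X Y Z : topologicalType) (A : set Z)
    (e : embedding X Y) (f : Z -> X) :
  {within A, continuous (e \o f)} -> {within A, continuous f}.
Proof.
move=> /within_continuousP cef; apply/within_continuousP => x Ax V.
rewrite nbhsE => -[U [/(emb_open e)[B oB UB] Ufx] UV].
have /(cef _ Ax) : nbhs (e (f x)) B.
  by apply: open_nbhs_nbhs; split=> //; rewrite UB in Ufx.
by apply: filterS => y BV Ay; apply: UV; rewrite UB; exact: BV.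
Qed.

Lemma within_continuous_pair (X Y Z : topologicalType) (A : set X)
    (f : X -> Y) (g : X -> Z) :
  {within A, continuous f} -> {within A, continuous g} ->
  {within A, continuous (fun x => (f x, g x))}.
Proof. by move=> cf cg x; exact: (cvg_pair (cf x) (cg x)). Qed.

Lemma snd_within_continuous (X Y : topologicalType) (A : set (X * Y)) :
  {within A, continuous snd}.
Proof. by apply: continuous_subspaceT => p; exact: cvg_snd. Qed.

Lemma emb_continuous (X Y : topologicalType) (e : embedding X Y) : continuous e.
Proof. by apply/continuousP => B oB; apply/(emb_open e); exists B. Qed.

(** * Isotopies from the identity *)

Section Isotopy.
Variable R : realType.

Definition homeo_refl (X : topologicalType) : homeo X X :=
  @Homeo X X id id (fun x => cvg_id) (fun x => cvg_id) (fun=> erefl) (fun=> erefl).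

Definition homeo_sym (X Y : topologicalType) (h : homeo X Y) : homeo Y X :=
  Homeo (@homeo_inv_continuous _ _ h) (@homeo_continuous _ _ h)
    (homeo_invK h) (homeo_funK h).

Definition homeo_comp (X Y Z : topologicalType) (g : homeo Y Z) (h : homeo X Y) :
    homeo X Z :=
  Homeo
    (fun x => continuous_comp (@homeo_continuous _ _ h x) (@homeo_continuous _ _ g _))
    (fun z => continuous_comp (@homeo_inv_continuous _ _ g z)
       (@homeo_inv_continuous _ _ h _))
    (can_comp (homeo_funK g) (homeo_funK h))
    (can_comp (homeo_invK h) (homeo_invK g)).

Definition cylinder (X : Type) : set (X * R) := [set: X] `*` [set` `[0, 1]].

Lemma cylinderE (X : Type) (p : X * R) : cylinder p <-> 0 <= p.2 <= 1.
Proof. by rewrite /cylinder /=; split=> [[_]|]; rewrite in_itv. Qed.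

Definition isotopy (X : topologicalType) (H : X * R -> X) : Prop :=
  [/\ {within @cylinder X, continuous H},
      forall x, H (x, 0) = x
    & forall t : R, 0 <= t <= 1 -> exists h : homeo X X, forall x, H (x, t) = h x].

Lemma isotopic_to_idP (X : topologicalType) (phi : homeo X X) :
  isotopic_to_id R phi <->
  exists2 H, isotopy H & forall x, H (x, 1) = phi x.
Proof. by split=> [[H [? ? ? ?]]|[H [? ? ?] ?]]; exists H. Qed.

Lemma isotopic_to_id_refl (X : topologicalType) : isotopic_to_id R (homeo_refl X).
Proof.
exists fst; split=> // [|t _]; last by exists (homeo_refl X).
by apply: continuous_subspaceT => p; exact: cvg_fst.
Qed.

(** Traversing the isotopy backwards and precomposing with the inverse of its end
    avoids inverting the intermediate stages, whose inverses are not obviously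
    jointly continuous. *)
Lemma isotopic_to_id_sym (X : topologicalType) (phi : homeo X X) :
  isotopic_to_id R phi -> isotopic_to_id R (homeo_sym phi).
Proof.
move=> [H [cH H0 H1 Hh]].
exists (H \o (fun p => (homeo_inv phi p.1, 1 - p.2))); split=> [||x|t t01] /=.
- apply: (within_continuous_comp (B := @cylinder X)) cH.
    by move=> p /cylinderE /andP[? ?]; apply/cylinderE; rewrite /= subr_ge0 gerBl; apply/andP.
  apply: within_continuous_pair; apply: continuous_subspaceT => p.
    by apply: continuous_comp; [exact: cvg_fst|exact: homeo_inv_continuous].
  by apply: cvgB; [exact: cvg_cst|exact: cvg_snd].
- by move=> x; rewrite subr0 H1 homeo_invK.
- by rewrite subrr H0.
have [|h hE] := Hh (1 - t); last by exists (homeo_comp h (homeo_sym phi)) => x.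
by case/andP: t01 => ? ?; rewrite subr_ge0 gerBl; apply/andP.
Qed.

Lemma isotopic_to_id_comp (X : topologicalType) (phi psi : homeo X X) :
  isotopic_to_id R phi -> isotopic_to_id R psi ->
  isotopic_to_id R (homeo_comp psi phi).
Proof.
move=> [H [cH H0 H1 Hh]] [K [cK K0 K1 Kh]].
exists (K \o (fun p => (H p, p.2))); split=> [||x|t t01] /=.
- apply: (within_continuous_comp (B := @cylinder X)) cK.
    by move=> p /cylinderE ?; apply/cylinderE.
  exact: within_continuous_pair cH (@snd_within_continuous _ _ _).
- by move=> x; rewrite H0 K0.
- by rewrite H1 K1.
have [h hE] := Hh t t01; have [k kE] := Kh t t01.
by exists (homeo_comp k h) => x; rewrite hE kE.
Qed.

(** The track of a point under an isotopy is connected, hence meets no clopen set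
    other than those containing the point. *)
Lemma isotopy_clopen (X : topologicalType) (H : X * R -> X) (K : set X) :
  isotopy H -> clopen K ->
  forall x t, 0 <= t <= 1 -> K x -> K (H (x, t)).
Proof.
move=> [cH H0 _] [oK cK] x t t01 Kx.
pose track := (fun s : R => H (x, s)) @` [set` `[0, 1]].
have ctrack : connected track.
  apply: connected_continuous_connected; first exact: segment_connected.
  apply: (within_continuous_comp (B := @cylinder X) (f := H)) cH.
    by move=> s /=; rewrite in_itv => s01; apply/cylinderE.
  apply: within_continuous_pair; apply: continuous_subspaceT => s.
    exact: cvg_cst.
  exact: cvg_id.
have trackt : track (H (x, t)) by exists t => //=; rewrite in_itv.
suff trackK : track `&` K = track by move: trackt; rewrite -trackK => -[].
apply: ctrack; [|by exists K|by exists K].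
by exists x; split=> //; exists 0; rewrite ?H0 //= in_itv /= lexx ler01.
Qed.

(** The complement of a clopen set is clopen, so a point outside it stays outside as
    well. *)
Lemma isotopy_clopen_iff (X : topologicalType) (H : X * R -> X) (K : set X) :
  isotopy H -> clopen K ->
  forall x t, 0 <= t <= 1 -> K (H (x, t)) <-> K x.
Proof.
move=> iH clK x t t01; split; last exact: (isotopy_clopen (K := K)).
apply: contraPP => nKx; apply: (isotopy_clopen (K := ~` K)) => //.
exact: clopenC.
Qed.

(** Both [h] and its inverse preserve the range of [e] because the hypothesis is an
    equivalence; hence the restriction is surjective, which would fail if [h] merely
    mapped the range into itself. *)
Lemma homeo_restrict (X Y : topologicalType) (e : embedding X Y) (h : homeo Y Y) :
  (forall y, range e (h y) <-> range e y) ->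
  exists h0 : homeo X X, forall x, e (h0 x) = h (e x).
Proof.
move=> he.
have [f fE] : {f : X -> X & forall x, e (f x) = h (e x)}.
  apply: (@choice _ _ (fun x y => e y = h (e x))) => x.
  by have [|y _ yE] := (he (e x)).2; [exists x|exists y].
have [g gE] : {g : X -> X & forall x, e (g x) = homeo_inv h (e x)}.
  apply: (@choice _ _ (fun x y => e y = homeo_inv h (e x))) => x.
  have [|y _ yE] := (he (homeo_inv h (e x))).1; last by exists y.
  by rewrite homeo_invK; exists x.
have lift_continuous (k : Y -> Y) (k0 : X -> X) :
    continuous k -> (forall x, e (k0 x) = k (e x)) -> continuous k0.
  move=> ck k0E; apply/continuousP => A /(emb_open e)[B oB ->].
  rewrite -comp_preimage (_ : e \o k0 = k \o e); last exact/funext.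
  apply: open_comp => // x _.
  by apply: continuous_comp; [exact: emb_continuous|exact: ck].
have fK : cancel f g by move=> x; apply: (@emb_inj _ _ e); rewrite gE fE homeo_funK.
have gK : cancel g f by move=> x; apply: (@emb_inj _ _ e); rewrite fE gE homeo_invK.
by exists (Homeo (lift_continuous _ _ (@homeo_continuous _ _ h) fE)
  (lift_continuous _ _ (@homeo_inv_continuous _ _ h) gE) fK gK).
Qed.

(** By [isotopy_clopen_iff] each stage of the isotopy restricts to a homeomorphism
    of [X]; the restricted stages form a continuous family because [e] is an
    embedding. *)
Lemma isotopic_to_id_restrict (X Y : topologicalType) (e : embedding X Y)
    (phi : homeo Y Y) :
  clopen (range e) -> isotopic_to_id R phi ->
  exists2 phi0 : homeo X X, isotopic_to_id R phi0 & forall x, e (phi0 x) = phi (e x).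
Proof.
move=> cle /isotopic_to_idP[H iH H1]; have [cH H0 Hh] := iH.
have rE (t : R) y : 0 <= t <= 1 -> range e (H (y, t)) <-> range e y.
  by move=> t01; exact: isotopy_clopen_iff.
have stage (t : R) : 0 <= t <= 1 ->
    exists h0 : homeo X X, forall x, e (h0 x) = H (e x, t).
  move=> t01; have [h hE] := Hh t t01.
  have [|h0 h0E] := homeo_restrict (e := e) (h := h).
    by move=> y; rewrite -hE; exact: rE.
  by exists h0 => x; rewrite h0E hE.
have [G GE] : {G : X * R -> X & forall p, 0 <= p.2 <= 1 ->
    e (G p) = H (e p.1, p.2)}.
  apply: (@choice _ _ (fun p y => 0 <= p.2 <= 1 -> e y = H (e p.1, p.2))) => p.
  (* Outside the unit interval the stages need not preserve the range of [e]. *)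
  have [t01|nt01] := boolP (0 <= p.2 <= 1); last by exists p.1.
  by have [h0 h0E] := stage _ t01; exists (h0 p.1) => _.
have [|phi0 phi0E] := stage 1; first by rewrite ler01 lexx.
exists phi0; last by move=> x; rewrite phi0E H1.
exists G; split=> [|x|x|t t01].
- apply: (within_continuous_emb (e := e)).
  apply: (within_continuous_eq (f := H \o (fun p => (e p.1, p.2)))).
    by move=> p /cylinderE p01; rewrite /= GE.
  apply: (within_continuous_comp (B := @cylinder Y)) cH.
    by move=> p /cylinderE p01; apply/cylinderE.
  apply: within_continuous_pair (@snd_within_continuous _ _ _).
  apply: continuous_subspaceT => p.
  by apply: continuous_comp; [exact: cvg_fst|exact: emb_continuous].
- by apply: (@emb_inj _ _ e); rewrite GE /= ?H0 ?lexx ?ler01.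
- by apply: (@emb_inj _ _ e); rewrite GE /= ?phi0E ?lexx ?ler01.
have [h0 h0E] := stage t t01; exists h0 => x.
by apply: (@emb_inj _ _ e); rewrite GE.
Qed.

Section Sum.
Variables X Y : topologicalType.

Lemma clopen_range_inl : clopen (range (inl_emb X Y)).
Proof.
split; first exact/inl_open/openT.
rewrite -[range _]setCK; apply: open_closedC.
rewrite (_ : ~` _ = inr @` [set: Y]); first exact/inr_open/openT.
by apply/seteqP; split=> [[x []|y _]|_ [y _ <-] []]; [exists x|exists y|].
Qed.

Lemma clopen_range_inr : clopen (range (inr_emb X Y)).
Proof.
split; first exact/inr_open/openT.
rewrite -[range _]setCK; apply: open_closedC.
rewrite (_ : ~` _ = inl @` [set: X]); first exact/inl_open/openT.
by apply/seteqP; split=> [[x _|y []]|_ [x _ <-] []]; [exists x|exists y|].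
Qed.

Definition sum_fun (X' Y' : Type) (f : X -> X') (g : Y -> Y') (z : X + Y) : X' + Y' :=
  match z with inl x => inl (f x) | inr y => inr (g y) end.

Lemma sum_fun_continuous (f : X -> X) (g : Y -> Y) :
  continuous f -> continuous g -> continuous (sum_fun f g).
Proof.
move=> cf cg [x|y] V /= nV.
- exact: (cf x (inl @^-1` V) nV).
- exact: (cg y (inr @^-1` V) nV).
Qed.

Definition homeo_sum (h : homeo X X) (k : homeo Y Y) : homeo (X + Y)%type (X + Y)%type.
Proof.
refine (@Homeo (X + Y)%type (X + Y)%type (sum_fun h k)
  (sum_fun (homeo_inv h) (homeo_inv k)) _ _ _ _).
- apply: sum_fun_continuous; exact: homeo_continuous.
- apply: sum_fun_continuous; exact: homeo_inv_continuous.
- by move=> [x|y] /=; rewrite homeo_funK.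
- by move=> [x|y] /=; rewrite homeo_invK.
Defined.

(** Near a point of one summand the side-by-side isotopy only involves that
    summand, since the summands are open. *)
Lemma isotopic_to_id_sum (h : homeo X X) (k : homeo Y Y) :
  isotopic_to_id R h -> isotopic_to_id R k -> isotopic_to_id R (homeo_sum h k).
Proof.
move=> [H [cH H0 H1 Hh]] [K [cK K0 K1 Kh]].
exists (fun p => sum_fun (fun x => H (x, p.2)) (fun y => K (y, p.2)) p.1).
split=> [|[x|y]|[x|y]|t t01] /=; rewrite ?H0 ?K0 ?H1 ?K1 //; last first.
  have [ht htE] := Hh t t01; have [kt ktE] := Kh t t01.
  by exists (homeo_sum ht kt) => -[x|y] /=; rewrite ?htE ?ktE.
move/within_continuousP: cH => cH; move/within_continuousP: cK => cK.
apply/within_continuousP => -[[x|y] t] /cylinderE t01 V nV; rewrite /= in t01.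
- have [|[P Q] /= [nP nQ] PQ] := cH (x, t) _ (inl @^-1` V) nV.
    exact/cylinderE.
  exists (inl @` P, Q) => /=; first by split=> //; exact: nbhs_inl.
  move=> [_ s] /= [[x' Px' <-] Qs] [_ s01].
  by apply: (PQ (x', s)) => //; split.
- have [|[P Q] /= [nP nQ] PQ] := cK (y, t) _ (inr @^-1` V) nV.
    exact/cylinderE.
  exists (inr @` P, Q) => /=; first by split=> //; exact: nbhs_inr.
  move=> [_ s] /= [[y' Py' <-] Qs] [_ s01].
  by apply: (PQ (y', s)) => //; split.
Qed.

End Sum.
End Isotopy.

(** * Isotopy classes of fields *)

Section FieldClasses.
Variables (R : realType) (n : nat) (F : fieldSystem R n).
Implicit Types M N : closedManifold R n.

Lemma field_equiv_refl M (f : fieldM F M) : field_equiv f f.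
Proof.
exists (homeo_refl M); split; first exact: isotopic_to_id_refl.
by rewrite pullM_id.
Qed.

Lemma field_equiv_sym M (f g : fieldM F M) : field_equiv f g -> field_equiv g f.
Proof.
move=> [phi [iphi ->]]; exists (homeo_sym phi); split; first exact: isotopic_to_id_sym.
rewrite -[RHS]/((pullM (homeo_sym phi) \o pullM phi) f).
rewrite -(pullM_comp (chi := homeo_refl M)) ?pullM_id // => x /=.
by rewrite homeo_invK.
Qed.

Lemma field_equiv_trans M (f g h : fieldM F M) :
  field_equiv f g -> field_equiv g h -> field_equiv f h.
Proof.
move=> [phi [iphi ->]] [psi [ipsi ->]]; exists (homeo_comp phi psi).
split; first exact: isotopic_to_id_comp.
exact/esym/(pullM_comp (phi := psi) (psi := phi)).
Qed.

Lemma fbar_eq M (f g : fieldM F M) : fbar f = fbar g <-> field_equiv f g.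
Proof.
split=> [[e]|fg].
  by have : field_class f g by rewrite e; exact: field_equiv_refl.
apply: eq_exist; apply/seteqP; split=> h.
- exact/field_equiv_trans/field_equiv_sym.
- exact: field_equiv_trans.
Qed.

Lemma fbar_surj M (c : Fbar F M) : exists f, c = fbar f.
Proof. by case: c => c [f cf]; exists f; apply: eq_exist. Qed.

(** Naturality of restriction turns the homeomorphism relating the fields on [M]
    into its restriction to [M0], which is again isotopic to the identity. *)
Lemma field_equiv_res M0 M (e : embedding M0 M) (f g : fieldM F M) :
  clopen (range e) -> field_equiv f g -> field_equiv (resMM e f) (resMM e g).
Proof.
move=> cle [phi [iphi ->]].
have [phi0 iphi0 phi0E] := isotopic_to_id_restrict cle iphi.
by exists phi0; split=> //; apply: pullM_resMM => x; rewrite /= phi0E.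
Qed.

(** The isotopies of the summands assemble into one of the union, and pulling [f]
    back along its end gives a field with the same restrictions as [g], hence [g]
    itself. *)
Lemma field_equiv_sum M N (f g : fieldM F (cm_sum M N)) :
  field_equiv (resMM (cm_inl M N) f) (resMM (cm_inl M N) g) ->
  field_equiv (resMM (cm_inr M N) f) (resMM (cm_inr M N) g) ->
  field_equiv f g.
Proof.
move=> [h [ih gh]] [k [ik gk]].
pose phi : homeo (cm_sum M N) (cm_sum M N) := homeo_sum h k.
exists phi; split; first exact: isotopic_to_id_sum.
apply: (bij_inj (fieldM_sum F M N)).
by rewrite gh gk (pullM_resMM (i' := cm_inl M N) (phi0 := h)) //
  (pullM_resMM (i' := cm_inr M N) (phi0 := k)).
Qed.

Lemma Fbar_sum_bijection M N :
  exists2 rho : Fbar F (cm_sum M N) -> Fbar F M * Fbar F N, bijective rho &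
    forall f, rho (fbar f) = (fbar (resMM (cm_inl M N) f), fbar (resMM (cm_inr M N) f)).
Proof.
have [rep repE] := choice (@fbar_surj (cm_sum M N)).
pose rho c := (fbar (resMM (cm_inl M N) (rep c)), fbar (resMM (cm_inr M N) (rep c))).
have rhoE f : rho (fbar f) = (fbar (resMM (cm_inl M N) f), fbar (resMM (cm_inr M N) f)).
  have /fbar_eq fr := repE (fbar f).
  congr pair; apply/fbar_eq/field_equiv_sym/field_equiv_res => //.
  - exact: clopen_range_inl.
  - exact: clopen_range_inr.
exists rho => //.
have rho_inj : injective rho.
  move=> c d; have [f ->] := fbar_surj c; have [g ->] := fbar_surj d.
  rewrite !rhoE => /pair_equal_spec[/fbar_eq fgM /fbar_eq fgN].
  exact/fbar_eq/field_equiv_sum.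
have [g gE] : {g & forall c, rho (g c) = c}.
  apply: (@choice _ _ (fun c d => rho d = c)) => -[c d].
  have [f ->] := fbar_surj c; have [f' ->] := fbar_surj d.
  have [glue _ glueK] := fieldM_sum F M N.
  by exists (fbar (glue (f, f'))); rewrite rhoE; case: (glueK (f, f')) => -> ->.
by exists g => [c|//]; apply: rho_inj; rewrite gE.
Qed.

End FieldClasses.

(** * Pullback of functions along a bijection *)

(** Precomposition preserves all operations definitionally, as these are
    pointwise. *)
Lemma fun_pullback_morphism (Q : pzSemiRingType) (A B : Type) (phi : A -> B) :
  semialg_morphism (fun_pullback phi : Defs.Fun Q B -> Defs.Fun Q A).
Proof. by []. Qed.

Lemma fun_pullback_isomorphism (Q : pzSemiRingType) (A B : Type) (phi : A -> B) :
  bijective phi -> semialg_isomorphism (fun_pullback phi : Defs.Fun Q B -> Defs.Fun Q A).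
Proof.
move=> [psi phiK psiK]; split; first exact: fun_pullback_morphism.
exists (fun_pullback psi); split; first exact: fun_pullback_morphism.
- by move=> z; apply/funext => b; rewrite /fun_pullback psiK.
- by move=> z; apply/funext => a; rewrite /fun_pullback phiK.
Qed.

Theorem proposition6p2 (R : realType) (n : nat) (S : completeSemiRingType)
    (C : strictMonoidalCategory) (F : fieldSystem R n)
    (M N : closedManifold R n) :
  exists rho : Fbar F (cm_sum M N) -> Fbar F M * Fbar F N,
    (forall f : fieldM F (cm_sum M N),
       rho (fbar f) = (fbar (resMM (cm_inl M N) f), fbar (resMM (cm_inr M N) f)))
    /\ semialg_isomorphism
         (state_pullback rho :
            state_tensor F (Qc S C) M N -> state_module F (Qc S C) (cm_sum M N))
    /\ semialg_isomorphism
         (state_pullback rho :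
            state_tensor F (Qm S C) M N -> state_module F (Qm S C) (cm_sum M N)).
Proof.
have [rho rho_bij rhoE] := Fbar_sum_bijection F M N.
exists rho; split; first exact: rhoE.
by split; exact: fun_pullback_isomorphism.
Qed.
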